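(* Let $d\ge 2$ and $k\ge 1$ be integers, let $U$ be a unitary operator on $\mathbb{C}^d$, and let $\Pi=\{\Pi_1,\ldots,\Pi_k\}$ be a POVM on $\mathbb{C}^d$ such that $\Pi_i=c_iP_i$ for every $i\in\{1,\ldots,k\}$, where $c_i>0$ and $P_i$ is an orthogonal projection on $\mathbb{C}^d$ (i.e. a linear map with $P_i=P_i^2=P_i^*$). Let $W$ be a non-trivial linear subspace of $\mathbb{C}^d$. Then the following are equivalent: (a) $\sqrt{\Pi_i}\,U(W)\subset W$ for every $i\in\{1,\ldots,k\}$; (b) $U(W)=W$ and $\Pi_i(W)\subset W$ for every $i\in\{1,\ldots,k\}$.
   Context: A POVM on $\mathbb{C}^d$ with $k$ outcomes is a set $\{\Pi_1,\ldots,\Pi_k\}$ of non-zero positive semi-definite operators on $\mathbb{C}^d$ with $\sum_{i=1}^k\Pi_i=\mathbb{I}$. $\sqrt{\Pi_i}$ denotes the positive semi-definite square root. A subspace of $\mathbb{C}^d$ is non-trivial if it is neither $\{0\}$ nor $\mathbb{C}^d$. *)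

(* Defs.v *)
From HB Require Import structures.
From mathcomp Require Import all_boot all_order all_algebra.
From mathcomp Require Import boolp classical_sets reals.
From mathcomp Require Export complex.

Set Implicit Arguments.
Unset Strict Implicit.
Unset Printing Implicit Defensive.

Import Order.TTheory GRing.Theory Num.Theory Num.Def.
Local Open Scope ring_scope.
Local Open Scope sesquilinear_scope.

(* C^d is 'cV[C]_d, an operator on C^d is a matrix A : 'M[C]_d acting by
   x |-> A *m x, and its adjoint is A ^t*. *)

(* In a numClosedFieldType, 0 <= z says that z is real and non-negative. *)
Definition psdmx (C : numClosedFieldType) (d : nat) (A : 'M[C]_d) : Prop :=
  A ^t* = A /\ forall x : 'cV[C]_d, 0 <= (x ^t* *m A *m x) 0 0.

Definition orthoprojmx (C : numClosedFieldType) (d : nat) (P : 'M[C]_d) : Prop :=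
  P = P *m P /\ P = P ^t*.

Definition povm (C : numClosedFieldType) (d k : nat) (Pi : 'I_k -> 'M[C]_d) : Prop :=
  (forall i, Pi i != 0 /\ psdmx (Pi i)) /\ \sum_(i < k) Pi i = 1%:M.

(* The positive semi-definite square root; it exists and is unique when A is
   positive semi-definite (sqrtmxP), and the default 0 is irrelevant. *)
Definition sqrtmx (C : numClosedFieldType) (d : nat) (A : 'M[C]_d) : 'M[C]_d :=
  xget 0 [set S : 'M[C]_d | psdmx S /\ S *m S = A]%classic.

Definition mximg (C : numClosedFieldType) (d : nat) (A : 'M[C]_d)
    (W : {vspace 'cV[C]_d}) : {vspace 'cV[C]_d} :=
  (linfun (mulmx A) @: W)%VS.

Lemma mximgP (C : numClosedFieldType) (d : nat) (A : 'M[C]_d)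
    (W : {vspace 'cV[C]_d}) (y : 'cV[C]_d) :
  reflect (exists2 x, x \in W & y = A *m x) (y \in mximg A W).
Proof.
apply: (iffP memv_imgP) => -[x xW ->]; exists x => //; by rewrite lfunE.
Qed.

Lemma trCM (C : numClosedFieldType) (m n p : nat)
    (A : 'M[C]_(m, n)) (B : 'M[C]_(n, p)) : (A *m B) ^t* = B ^t* *m A ^t*.
Proof. by rewrite trmx_mul map_mxM. Qed.

Lemma psdmx_sqrt_exists (C : numClosedFieldType) (d : nat) (A : 'M[C]_d) :
  psdmx A -> exists S : 'M[C]_d, psdmx S /\ S *m S = A.
Proof.
move=> [AH Apos].
have /orthomx_spectralP AE : A \is normalmx by apply/normalmxP; rewrite AH.
set U := spectralmx A in AE; set D := spectral_diag A in AE.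
have Uu : U \is unitarymx by exact: spectral_unitarymx.
have UU : U *m U ^t* = 1%:M by exact/unitarymxP.
rewrite invmx_unitary // in AE.
have D0 i : 0 <= D 0 i.
  have := Apos (U ^t* *m delta_mx i 0).
  rewrite trCM trmxCK AE !mulmxA -(mulmxA _ U) UU mulmx1 -(mulmxA _ U) UU mulmx1.
  rewrite mul_mx_diag !mxE (bigD1 i) //= big1 ?addr0; last first.
    by move=> j ji; rewrite !mxE (negPf ji) !(andbF, andFb, mulr0).
  by rewrite !mxE !eqxx /= rmorph1 mul1r mulr1.
pose E := map_mx sqrtC D.
have E0 i : 0 <= E 0 i by rewrite mxE sqrtC_ge0.
have EC : (diag_mx E) ^t* = diag_mx E.
  apply/matrixP => i j; rewrite !mxE eq_sym.
  have [->|_] := eqVneq i j; last by rewrite !mulr0n rmorph0.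
  by rewrite !mulr1n geC0_conj // sqrtC_ge0.
exists (U ^t* *m diag_mx E *m U); split; first split.
- by rewrite !trCM trmxCK EC mulmxA.
- move=> x; set y := U *m x.
  have -> : x ^t* *m (U ^t* *m diag_mx E *m U) *m x = y ^t* *m diag_mx E *m y.
    by rewrite /y trCM !mulmxA.
  rewrite mul_mx_diag mxE sumr_ge0 // => i _; rewrite !mxE.
  rewrite mulrAC mulr_ge0 ?sqrtC_ge0 //.
  by rewrite mulrC mul_conjC_ge0.
- rewrite AE !mulmxA -(mulmxA _ U) UU mulmx1 -(mulmxA _ (diag_mx E) (diag_mx E)) mulmx_diag.
  congr (_ *m diag_mx _ *m _); apply/rowP => i.
  by rewrite !mxE -expr2 sqrtCK.
Qed.

Lemma psdmx_sqrt_unique (C : numClosedFieldType) (d : nat) (S T : 'M[C]_d) :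
  psdmx S -> psdmx T -> S *m S = T *m T -> S = T.
Proof.
move=> [SH S0] [TH T0] ST; apply/eqP; rewrite -subr_eq0; apply/eqP.
set D := S - T.
have DH : D ^t* = D by rewrite /D linearB /= map_mxB SH TH.
have SD : S *m D + D *m T = 0.
  by rewrite /D mulmxBr mulmxBl -ST addrA subrK subrr.
have /orthomx_spectralP DE : D \is normalmx by apply/normalmxP; rewrite DH.
set U := spectralmx D in DE; set L := spectral_diag D in DE.
have Uu : U \is unitarymx by exact: spectral_unitarymx.
have UU : U *m U ^t* = 1%:M by exact/unitarymxP.
rewrite invmx_unitary // in DE.
suff L0 : L = 0.
  by rewrite DE L0 (_ : diag_mx 0 = 0) ?mulmx0 ?mul0mx ?linear0.
apply/rowP => i; rewrite [RHS]mxE; apply/eqP/negPn/negP => Li.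
pose x : 'cV[C]_d := U ^t* *m delta_mx i 0.
have Dx : D *m x = L 0 i *: x.
  rewrite /x {1}DE -!mulmxA (mulmxA U) UU mul1mx scalemxAr; congr (_ *m _).
  apply/colP => j; rewrite mul_diag_mx !mxE.
  by case: eqVneq => [->|]; rewrite ?mulr0.
have xD : x ^t* *m D = (L 0 i)^* *: x ^t*.
  by rewrite -{1}DH -trCM Dx linearZ /= map_mxZ.
have xx : x ^t* *m x = 1%:M.
  rewrite /x trCM trmxCK !mulmxA -(mulmxA _ U) UU mulmx1.
  apply/matrixP => a b; rewrite !ord1 !mxE (bigD1 i) //= big1 ?addr0; last first.
    by move=> j ji; rewrite !mxE (negPf ji) mulr0.
  by rewrite !mxE !eqxx /= rmorph1 mulr1.
clearbody x.
have Lr : (L 0 i)^* = L 0 i.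
  have : x ^t* *m D *m x = L 0 i *: 1%:M.
    by rewrite -mulmxA Dx -scalemxAr xx.
  rewrite xD -scalemxAl xx => /matrixP /(_ 0 0); rewrite !mxE eqxx.
  by rewrite !mulr1.
have : x ^t* *m (S *m D + D *m T) *m x = 0 by rewrite SD mulmx0 mul0mx.
rewrite mulmxDr mulmxDl !mulmxA xD Lr -(mulmxA _ D x) Dx -!scalemxAl -scalemxAr.
rewrite -scalerDr => /matrixP /(_ 0 0) /eqP.
rewrite mxE [in X in _ * X]mxE [X in _ == X]mxE mulf_eq0 (negPf Li) /=.
rewrite paddr_eq0 // => /andP[/eqP s0 /eqP t0].
have : (x ^t* *m D *m x) 0 0 = (x ^t* *m S *m x) 0 0 - (x ^t* *m T *m x) 0 0.
  by rewrite /D mulmxBr mulmxBl [LHS]mxE [X in _ + X]mxE.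
rewrite s0 t0 subrr xD -scalemxAl xx !mxE Lr eqxx mulr1 => L0.
by rewrite L0 eqxx in Li.
Qed.

Lemma sqrtmxP (C : numClosedFieldType) (d : nat) (A S : 'M[C]_d) :
  psdmx A -> (psdmx S /\ S *m S = A) <-> S = sqrtmx A.
Proof.
move=> /psdmx_sqrt_exists [T TP].
have [sqP sqE] : psdmx (sqrtmx A) /\ sqrtmx A *m sqrtmx A = A.
  by apply: (@xgetPex _ 0 [set S' | psdmx S' /\ S' *m S' = A]%classic); exists T.
split=> [[SP SE]|-> //].
by apply: psdmx_sqrt_unique => //; rewrite SE sqE.
Qed.

(* Main.v *)
Require Import Defs.
From mathcomp Require Import all_boot all_order all_algebra.
From mathcomp Require Import reals complex.

(** The square root of [c *: P], for [c > 0] and [P] an orthogonal projection,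
    is [sqrtC c *: P]: up to a nonzero scalar it is [c *: P] itself.  Hence
    condition (a) says exactly that every [Pi i *m U] maps [W] into itself
    ([mximg_sqrtmx_scale_proj]).  Summing over [i] and using that the [Pi i]
    add up to the identity, [U] maps [W] into itself; as [U] is invertible, the
    dimensions force [U(W) = W], and then [Pi i (W) = Pi i (U(W))] lies in [W].
    Conversely, if [U(W) = W] then [Pi i (U(W)) = Pi i (W)]. *)

Import Order.TTheory GRing.Theory Num.Theory.
Local Open Scope ring_scope.
Local Open Scope complex_scope.
Local Open Scope sesquilinear_scope.

Lemma mximg_subvP (C : numClosedFieldType) (d : nat) (A : 'M[C]_d)
    (W V : {vspace 'cV[C]_d}) :
  (forall x, x \in W -> A *m x \in V) <-> (mximg A W <= V)%VS.
Proof.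
split=> [AWV|/subvP AWV x xW]; last by apply/AWV/mximgP; exists x.
by apply/subvP => _ /mximgP[x xW ->]; apply: AWV.
Qed.

Lemma mximgM (C : numClosedFieldType) (d : nat) (A B : 'M[C]_d)
    (W : {vspace 'cV[C]_d}) :
  mximg (A *m B) W = mximg A (mximg B W).
Proof.
apply/vspaceP => y; apply/mximgP/mximgP => [[x xW ->]|[_ /mximgP[x xW ->] ->]].
  by exists (B *m x); rewrite ?mulmxA //; apply/mximgP; exists x.
by exists x; rewrite ?mulmxA.
Qed.

Lemma mximgZ (C : numClosedFieldType) (d : nat) (a : C) (A : 'M[C]_d)
    (W : {vspace 'cV[C]_d}) :
  a != 0 -> mximg (a *: A) W = mximg A W.
Proof.
move=> a0; apply/vspaceP => y; apply/mximgP/mximgP => -[x xW ->].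
  by exists (a *: x); rewrite ?memvZ // -scalemxAl -scalemxAr.
exists (a^-1 *: x); first exact: memvZ.
by rewrite -scalemxAl -scalemxAr scalerA divff // scale1r.
Qed.

(** An injective operator preserves dimension, so an inclusion is enough. *)
Lemma mximg_unitmx_eq (C : numClosedFieldType) (d : nat) (A : 'M[C]_d)
    (W : {vspace 'cV[C]_d}) :
  A \in unitmx -> (mximg A W <= W)%VS -> mximg A W = W.
Proof.
move=> Au AW; apply/eqP; rewrite eqEdim AW /= limg_dim_eq //.
apply/eqP; rewrite -subv0; apply/subvP => x.
rewrite memv_cap memv0 memv_ker lfunE /= => /andP[_ /eqP Ax0].
by rewrite -[x](mulKmx Au) Ax0 mulmx0.
Qed.

(** A projection satisfies [x^* P x = (P x)^* (P x)], which is a sum of squared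
    moduli. *)
Lemma psdmx_scale_proj (C : numClosedFieldType) (d : nat) (a : C)
    (P : 'M[C]_d) :
  0 <= a -> orthoprojmx P -> psdmx (a *: P).
Proof.
move=> a0 [PP PH]; split=> [|x].
  by rewrite linearZ /= map_mxZ -PH /=; congr (_ *: _); exact: geC0_conj.
rewrite -scalemxAr -scalemxAl mxE mulr_ge0 //.
have -> : x ^t* *m P *m x = (P *m x) ^t* *m (P *m x).
  by rewrite trCM -PH mulmxA -(mulmxA _ P P) -PP.
rewrite mxE sumr_ge0 // => j _.
by rewrite !mxE mulrC mul_conjC_ge0.
Qed.

Lemma sqrtmx_scale_proj (C : numClosedFieldType) (d : nat) (a : C)
    (P : 'M[C]_d) :
  0 <= a -> orthoprojmx P -> sqrtmx (a *: P) = sqrtC a *: P.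
Proof.
move=> a0 oP; apply/esym/sqrtmxP; first exact: psdmx_scale_proj.
split; first by apply: psdmx_scale_proj; rewrite ?sqrtC_ge0.
by case: oP => PP _; rewrite -scalemxAl -scalemxAr scalerA -expr2 sqrtCK -PP.
Qed.

(** Subspaces do not see nonzero scalars, so on them the square root of a
    scaled projection acts as the scaled projection. *)
Lemma mximg_sqrtmx_scale_proj (C : numClosedFieldType) (d : nat) (a : C)
    (P : 'M[C]_d) (W : {vspace 'cV[C]_d}) :
  0 < a -> orthoprojmx P -> mximg (sqrtmx (a *: P)) W = mximg (a *: P) W.
Proof.
move=> a0 oP; rewrite sqrtmx_scale_proj ?ltW //.
by rewrite !mximgZ ?sqrtC_eq0 ?gt_eqF.
Qed.

(** A resolution of the identity writes [U *m x] as the sum of the vectors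
    [A i *m (U *m x)], so it stays in [W] as soon as each of them does.  This
    turns invariance under the composites into invariance under [U], and then
    under each [A i]. *)
Lemma mximg_resolution_iff (C : numClosedFieldType) (d k : nat) (U : 'M[C]_d)
    (A : 'I_k -> 'M[C]_d) (W : {vspace 'cV[C]_d}) :
  U \in unitmx -> \sum_(i < k) A i = 1%:M ->
  (forall i, (mximg (A i) (mximg U W) <= W)%VS) <->
  (mximg U W = W /\ forall i, (mximg (A i) W <= W)%VS).
Proof.
move=> Uu sumA; split=> [AUW|[-> //]].
suff UW : mximg U W = W by split=> // i; rewrite -{1}UW.
apply: mximg_unitmx_eq => //; apply/mximg_subvP => x xW.
rewrite -[U *m x]mul1mx -sumA mulmx_suml; apply: memv_suml => i _.
by move/mximg_subvP: (AUW i); apply; apply/mximgP; exists x.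
Qed.

Theorem theorem7 (R : realType) (d k : nat) (hd : (2 <= d)%N) (hk : (1 <= k)%N)
    (U : 'M[R[i]]_d) (hU : U \is unitarymx)
    (Pi : 'I_k -> 'M[R[i]]_d) (hPi : povm Pi)
    (c : 'I_k -> R) (P : 'I_k -> 'M[R[i]]_d)
    (hcP : forall i : 'I_k,
       [/\ Pi i = (c i)%:C *: P i, 0 < c i & orthoprojmx (P i)])
    (W : {vspace 'cV[R[i]]_d}) (hW0 : W <> 0%VS) (hWT : W <> fullv) :
  (forall i : 'I_k, (mximg (sqrtmx (Pi i) *m U) W <= W)%VS)
  <->
  (mximg U W = W /\ forall i : 'I_k, (mximg (Pi i) W <= W)%VS).
Proof.
have sqrtE i : mximg (sqrtmx (Pi i) *m U) W = mximg (Pi i) (mximg U W).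
  have [-> c0 oP] := hcP i.
  by rewrite mximgM mximg_sqrtmx_scale_proj // ltcR.
case: hPi => _ sumPi.
have <- := mximg_resolution_iff _ _ _ _ _ W (unitarymx_unit hU) sumPi.
by split=> H i; move: (H i); rewrite sqrtE.
Qed.
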